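(* (1) Let $H$ be a finitely generated undistorted subgroup of a finitely generated group $G$, and suppose that the length function $l$ on $H$ is special. Then there exists an extension $L$ of $l$ to $G$. (2) Let $H$ be a finitely generated group, and let $l:H\to\{0,1,2,\dots\}$ be any function satisfying the $(D)$ condition. If $l$ is not special, then there exists an undistorted embedding of $H$ into a finitely generated group $G$ such that $l$ does not extend to $G$ (i.e. there is no extension of $l$ to $G$). (3) If $H$ is a distorted finitely generated subgroup of a finitely generated group $G$, then there is a special length function $l$ on $H$ admitting no extension to $G$.
   Context: For a group $G$ with finite generating set $X$, $|g|_X$ denotes word length. If $H$ is a subgroup of $G$ (or is embedded in $G$), with $H$ and $G$ generated by finite sets $Y$ and $X$, the distortion function is $\Delta_H^G(r)=\max\{|h|_Y: h\in H,\ |h|_X\le r\}$ for $r\in\mathbb{N}=\{1,2,\dots\}$. $H$ is undistorted in $G$ if $\Delta_H^G(r)\preceq r$, i.e. there is $c>0$ with $\Delta_H^G(r)\le cr$ for all $r$ (for infinite $H$ this is the same as $\Delta_H^G(r)\approx r$, where $f\approx g$ means $f\preceq g\preceq f$ and $f\preceq g$ means $f(r)\le c\,g(cr)$ for some positive integer $c$ and all $r$); otherwise it is distorted. A function $l:H\to\{0,1,2,\dots\}$ on a group $H$ satisfies the $(D)$ condition (and is then called a length function) if: (D1) $l(h)=l(h^{-1})$ for all $h\in H$, and $l(h)=0$ if and only if $h=1$; (D2) $l(h_1h_2)\le l(h_1)+l(h_2)$ for all $h_1,h_2\in H$; (D3) there exists $a>0$ such that $\#\{h\in H: l(h)\le r\}\le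 a^r$ for every $r\in\mathbb{N}$. Two nonnegative functions $f,g$ on a group $H$ are $\Theta$-equivalent, $f=\Theta(g)$, if there is $c>0$ such that $f(h)\le c\,g(h)$ and $g(h)\le c\,f(h)$ for all $h\in H$. For a finitely generated subgroup $H$ of a finitely generated group $G$ and a function $l:H\to\{0,1,2,\dots\}$ satisfying $(D)$, a function $L:G\to\{0,1,2,\dots\}$ is an extension of $l$ (to $G$) if $L$ satisfies the $(D)$ condition on $G$ and the restriction of $L$ to $H$ is $\Theta$-equivalent to $l$. A length function $l$ on a group $H$ generated by a finite set $Y$ is special if there exists a subadditive (i.e. $f(r+s)\le f(r)+f(s)$) nondecreasing function $f:\{0,1,2,\dots\}\to\{0,1,2,\dots\}$ such that $l(h)=\Theta(f(|h|_Y))$ as functions of $h\in H$. *)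

(* Defs.v *)
From mathcomp Require Export all_boot all_order.
From mathcomp Require Export monoid.
From mathcomp Require Export boolp classical_sets functions cardinality.

Set Implicit Arguments.
Unset Strict Implicit.
Unset Printing Implicit Defensive.

Local Open Scope classical_set_scope.
Local Open Scope nat_scope.

(* Default value 0 when the minimum (resp. maximum) does not exist. *)
Definition nat_min (A : set nat) : nat := xget 0 (A `&` lbound A).
Definition nat_max (A : set nat) : nat := xget 0 (A `&` ubound A).

(* A finite subset of a group is given by a list of its elements. *)

Definition words (G : groupType) (X : seq G) (g : G) : set (seq G) :=
  [set w | (forall x, x \in w -> x \in X \/ (x^-1)%g \in X) /\
           (\prod_(x <- w) x)%g = g].

Definition generates (G : groupType) (X : seq G) : Prop :=
  forall g : G, words X g !=set0.

Definition word_length (G : groupType) (X : seq G) (g : G) : nat :=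
  nat_min [set size w | w in words X g].

(* The subgroup is the image of [phi : H -> G], an injective morphism: either
   an embedding, or the inclusion [\val] of a [subGroupType]. *)
Definition distortion (H G : groupType) (Y : seq H) (X : seq G)
    (phi : H -> G) (r : nat) : nat :=
  nat_max [set word_length Y h | h in [set h | word_length X (phi h) <= r]].

(* Here and below the existence of a real constant amounts to that of a natural
   one, since the constants may be enlarged. *)
Definition undistorted (H G : groupType) (Y : seq H) (X : seq G)
    (phi : H -> G) : Prop :=
  exists2 c, 0 < c & forall r, 0 < r -> distortion Y X phi r <= c * r.

Definition distorted (H G : groupType) (Y : seq H) (X : seq G)
    (phi : H -> G) : Prop :=
  ~ undistorted Y X phi.

Record length_function (H : groupType) (l : H -> nat) : Prop := {
  length_inv : forall h, l h = l (h^-1)%g;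
  length_eq0 : forall h, l h = 0 <-> h = 1%g;
  length_mul : forall h1 h2, l (h1 * h2)%g <= l h1 + l h2;
  length_card : exists2 a, 0 < a &
    forall r, 0 < r -> ([set h | l h <= r] #<= `I_(a ^ r))%card
}.

Definition theta_equiv (T : Type) (f g : T -> nat) : Prop :=
  exists2 c, 0 < c & forall t, f t <= c * g t /\ g t <= c * f t.

Definition extension (H G : groupType) (phi : H -> G) (l : H -> nat)
    (L : G -> nat) : Prop :=
  length_function L /\ theta_equiv (L \o phi) l.

Definition special (H : groupType) (Y : seq H) (l : H -> nat) : Prop :=
  exists f : nat -> nat,
    [/\ forall r s, f (r + s) <= f r + f s,
        {homo f : r s / r <= s} &
        theta_equiv l (fun h => f (word_length Y h))].

(* Main.v *)
(** A length function on G is at most a multiple of the word length of G, so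
    the word length of a distorted subgroup has no extension. If H is
    undistorted and l is equivalent to f(|h|_Y), let L(g) be the least total
    weight of an expression of g as a product of generators of G (of weight 1)
    and elements h of H (of weight l(h)); the number of expressions of weight
    r is at most exponential in r, and f(|g|_X) is subadditive, whence L
    dominates l on H.

    If l is not special, there are pairs (z, k) in H with 4|k| <= |z| and
    l(k)/l(z) arbitrarily large, and they can be chosen so sparse that the map
    kappa : z |-> k is 1-Lipschitz on its domain Z (to which 1 is added, with
    kappa(1) = 1). It is enough to embed H without distortion in a finitely
    generated group G where kappa(z) is the value at z of one word with
    coefficients in G: then L(kappa(z)) <= C L(z) for every length function L
    on G.

    G is a group of permutations of the points (a, s), where a is in H and s
    is a finite list of pairs (p, t) with p in H and t in Z^2, taken in two
    copies called sheets; H acts on the first sheet by h (a, s) = (h a, s),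
    and two more permutations act on it: over every a in Z, P moves the tag t
    of the head (p, t) of s one step to the right, and it multiplies p by
    kappa(a) when t enters the quadrant of the twisted tags; U moves the tags
    over a = 1 one step up. Then the commutator of z^-1 P z and U fixes all
    points except those of the form (1, (p, t0) :: r), where it multiplies p
    by kappa(z): this is the action of kappa(z) on (p, r), transported by the
    injection (p, r) |-> (1, (p, t0) :: r), and the two sheets leave room to
    extend this injection to a permutation. H is not distorted because there
    is an integer-valued function on the points which changes by at most 1
    under the generators of G, and whose value at (h, [::]) is |h|_Y. *)

Require Import Defs.
From HB Require Import structures.
From mathcomp Require Import ssralg ssrint ssrnum zify.

Set Implicit Arguments.
Unset Strict Implicit.
Unset Printing Implicit Defensive.

Local Open Scope classical_set_scope.
Local Open Scope nat_scope.

(** * Length functions *)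

Lemma nat_minP (A : set nat) : A !=set0 -> A (nat_min A) /\ lbound A (nat_min A).
Proof.
move=> [n An]; apply: (@xgetPex _ 0 (A `&` lbound A)).
have exA : exists n, `[< A n >] by exists n; apply/asboolP.
case: (ex_minnP exA) => m /asboolP Am mP; exists m; split => // k Ak.
exact/mP/asboolP.
Qed.

Lemma nat_maxP (A : set nat) b :
  A !=set0 -> ubound A b -> A (nat_max A) /\ ubound A (nat_max A).
Proof.
move=> [n An] Ab; apply: (@xgetPex _ 0 (A `&` ubound A)).
have exA : exists n, `[< A n >] by exists n; apply/asboolP.
have leA k : `[< A k >] -> k <= b by move/asboolP/Ab.
case: (ex_maxnP exA leA) => m /asboolP Am mP; exists m; split => // k Ak.
exact/mP/asboolP.
Qed.

Lemma nat_max_le (A : set nat) b : ubound A b -> nat_max A <= b.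
Proof.
move=> Ab; have [A0|A0] := pselect (A !=set0).
  by have [/Ab] := nat_maxP A0 Ab.
rewrite /nat_max xgetPN // => x [Ax _]; apply: A0; by exists x.
Qed.

Lemma card_leI_seq (T : choiceType) (A : set T) n :
  (A #<= `I_n)%card <-> exists2 s : seq T, size s <= n & forall x, A x -> x \in s.
Proof.
split=> [An|[[|x0 s] sn As]].
- have finA : finite_set A by apply/finite_set_leP; exists n.
  exists (finmap.enum_fset (fset_set A)); first exact: geq_card_fset_set.
  by move=> x Ax; rewrite in_fset_set// inE.
- suff -> : A = set0 by apply: card_ge0.
  by rewrite predeqE => x; split=> [/As|].
have sub : A `<=` [set nth x0 (x0 :: s) i | i in `I_n].
  move=> x /As xs; exists (index x (x0 :: s)); last exact: nth_index.
  by rewrite /mkset (leq_trans _ sn)// index_mem.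
exact: card_le_trans (subset_card_le sub) (card_image_le _ _).
Qed.

(** * Lengths defined by weighted expressions *)

Section WeightedLength.
Variables (G : groupType) (P : G -> nat -> Prop).

Definition expressions (g : G) : set (seq (G * nat)) :=
  [set s | (forall u, u \in s -> P u.1 u.2) /\ (\prod_(u <- s) u.1)%g = g].

Definition weighted_length (g : G) : nat :=
  nat_min [set \sum_(u <- s) u.2 | s in expressions g].

Hypothesis exprP : forall g, expressions g !=set0.

Lemma weighted_lengthP g :
  exists2 s, expressions g s & weighted_length g = \sum_(u <- s) u.2.
Proof.
have A0 : [set \sum_(u <- s) u.2 | s in expressions g] !=set0.
  by have [s gs] := exprP g; exists (\sum_(u <- s) u.2); exists s.
by have [[s gs e] _] := nat_minP A0; exists s; rewrite /weighted_length -?e.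
Qed.

Lemma weighted_length_le g s :
  expressions g s -> weighted_length g <= \sum_(u <- s) u.2.
Proof.
move=> gs; have A0 : [set \sum_(u <- s) u.2 | s in expressions g] !=set0.
  by exists (\sum_(u <- s) u.2); exists s.
by have [_] := nat_minP A0; apply; exists s.
Qed.

Lemma weighted_length_sub g w : P g w -> weighted_length g <= w.
Proof.
move=> gw; have <- : \sum_(u <- [:: (g, w)]) u.2 = w by rewrite big_seq1.
apply: weighted_length_le; split=> [u|]; last by rewrite big_seq1.
by rewrite inE => /eqP->.
Qed.

Lemma weighted_length1 : weighted_length 1%g = 0.
Proof.
apply/eqP; rewrite -leqn0; have <- : \sum_(u <- [::] : seq (G * nat)) u.2 = 0.
  by rewrite big_nil.
by apply: weighted_length_le; split; rewrite ?big_nil.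
Qed.

Lemma weighted_lengthM g h :
  weighted_length (g * h)%g <= weighted_length g + weighted_length h.
Proof.
have [s [sP sg] ->] := weighted_lengthP g.
have [t [tP th] ->] := weighted_lengthP h.
rewrite -big_cat; apply: weighted_length_le; split; last by rewrite big_cat sg th.
by move=> u; rewrite mem_cat => /orP[/sP|/tP].
Qed.

(** Source of all lower bounds on weighted lengths: [N] of a product is at most the sum of [N] over
    the factors of a minimal expression. *)
Lemma subadditive_le_weighted_length (N : G -> nat) C :
    N 1%g = 0 -> (forall g h, N (g * h)%g <= N g + N h) ->
    (forall g w, P g w -> N g <= C * w) ->
  forall g, N g <= C * weighted_length g.
Proof.
move=> N1 NM NP g; have [s [sP <-] ->] := weighted_lengthP g.
elim: s sP => [|u s IHs] sP; first by rewrite !big_nil N1.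
rewrite !big_cons mulnDr (leq_trans (NM _ _))// leq_add//.
  by apply/NP/sP; rewrite inE eqxx.
by apply: IHs => v vs; apply: sP; rewrite inE vs orbT.
Qed.

Hypothesis P0 : forall g, P g 0 -> g = 1%g.

Lemma weighted_length_eq0 g : weighted_length g = 0 <-> g = 1%g.
Proof.
split=> [|->]; last exact: weighted_length1.
have [s [sP <-] ->] := weighted_lengthP g.
elim: s sP => [|u s IHs] sP; first by rewrite !big_nil.
rewrite !big_cons => /eqP; rewrite addn_eq0 => /andP[/eqP u0 /eqP s0].
rewrite (@P0 u.1) ?mul1g; last by rewrite -u0; apply: sP; rewrite inE eqxx.
by apply: IHs => // v vs; apply: sP; rewrite inE vs orbT.
Qed.

Hypothesis PV : forall g w, P g w -> P (g^-1)%g w.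

Lemma weighted_lengthV g : weighted_length g = weighted_length (g^-1)%g.
Proof.
suff leV h : weighted_length (h^-1)%g <= weighted_length h.
  by apply/eqP; rewrite eqn_leq leV -{1}[g]invgK leV.
have [s [sP <-] ->] := weighted_lengthP h.
elim: s sP => [|u s IHs] sP; first by rewrite !big_nil invg1 weighted_length1.
rewrite !big_cons invgM addnC (leq_trans (weighted_lengthM _ _))// leq_add//.
  by apply: IHs => v vs; apply: sP; rewrite inE vs orbT.
by apply/weighted_length_sub/PV/sP; rewrite inE eqxx.
Qed.

Variable A : nat.
Hypothesis cardP : forall w, 0 < w -> ([set g | P g w] #<= `I_(A ^ w))%card.

(* Splitting off the first letter of positive weight, the number of elements
   of weighted length at most [r] is at most
   [1 + \sum_(1 <= w <= r) A ^ w * (2 * A) ^ (r - w) = 1 + A ^ r * (2 ^ r - 1)]. *)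
Lemma weighted_length_card r :
  0 < A -> ([set g | weighted_length g <= r] #<= `I_((2 * A) ^ r))%card.
Proof.
move=> A0; apply/card_leI_seq; elim/ltn_ind: r => r IHr.
have /choice[S SP] w : exists s : seq G,
    0 < w -> size s <= A ^ w /\ forall g, P g w -> g \in s.
  have [w0|w0] := ltnP 0 w; last by exists [::].
  by have [s] := (card_leI_seq _ _).1 (cardP w0); exists s.
have /choice[B BP] k : exists s : seq G, k < r ->
    size s <= (2 * A) ^ k /\ forall g, weighted_length g <= k -> g \in s.
  have [kr|kr] := ltnP k r; last by exists [::].
  by have [s] := IHr k kr; exists s.
pose T := [seq [seq (g * h)%g | g <- S w, h <- B (r - w)] | w <- iota 1 r].
exists (1%g :: flatten T).
  have szT : size (flatten T) <= \sum_(1 <= w < r.+1) A ^ w * (2 * A) ^ (r - w).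
    rewrite size_flatten sumnE /shape !big_map /index_iota subSS subn0.
    rewrite big_seq [leqRHS]big_seq.
    apply: leq_sum => w; rewrite mem_iota => wr; rewrite size_allpairs.
    have [|sS _] := SP w; first by lia.
    have [|sB _] := BP (r - w); first by lia.
    exact: leq_mul.
  have sumT : \sum_(1 <= w < r.+1) A ^ w * (2 * A) ^ (r - w) = A ^ r * (2 ^ r - 1).
    elim: (r) => [|k IHk]; first by rewrite big_nil expn0 subn1 muln0.
    rewrite big_nat_recr//= subnn expn0 muln1.
    rewrite (eq_big_nat _ _ (F2 := fun w => A ^ w * (2 * A) ^ (k - w) * (2 * A))).
      rewrite -big_distrl/= IHk !expnS.
      have : 0 < 2 ^ k by rewrite expn_gt0.
      by nia.
    by move=> w wk; rewrite subSn ?expnSr ?mulnA//; lia.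
  rewrite /= expnMn (leq_trans (n := 1 + A ^ r * (2 ^ r - 1)))//.
    by rewrite ltnS -sumT.
  have : 0 < A ^ r by rewrite expn_gt0 A0.
  have : 0 < 2 ^ r by rewrite expn_gt0.
  by nia.
move=> g; rewrite /mkset; have [s [sP <-] ->] := weighted_lengthP g.
elim: s sP => [|u s IHs] sP; first by rewrite !big_nil inE eqxx.
have uP : P u.1 u.2 by apply: sP; rewrite inE eqxx.
have {}sP : forall v, v \in s -> P v.1 v.2.
  by move=> v vs; apply: sP; rewrite inE vs orbT.
rewrite !big_cons; have [u0|u0] := posnP u.2.
  by rewrite (P0 (g := u.1)) -?u0// mul1g u0 add0n; apply: IHs.
move=> sr; rewrite inE; apply/orP; right; apply/flattenP.
exists [seq (g * h)%g | g <- S u.2, h <- B (r - u.2)].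
  by apply/mapP; exists u.2; rewrite // mem_iota; lia.
apply/allpairs_f; first by have [_] := SP _ u0; apply.
have [|_] := BP (r - u.2); first by lia.
by apply; rewrite (leq_trans (weighted_length_le (s := s) _))//; lia.
Qed.

End WeightedLength.

(** Word length is the weighted length in which generators and their inverses have weight 1; the (D)
    condition then follows from the general results. *)
Definition letter (G : groupType) (X : seq G) (g : G) (w : nat) : Prop :=
  (g \in X \/ (g^-1)%g \in X) /\ w = 1.

Lemma letterV (G : groupType) (X : seq G) g w :
  letter X g w -> letter X (g^-1)%g w.
Proof. by rewrite /letter invgK => -[[] gX ->]; split; auto. Qed.

Lemma card_letter (G : groupType) (X : seq G) w :
  0 < w -> ([set g | letter X g w] #<= `I_((2 * size X).+1 ^ w))%card.
Proof.
move=> w0; apply/card_leI_seq; exists (X ++ [seq (x^-1)%g | x <- X]).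
  rewrite size_cat size_map addnn -mul2n (leq_trans (leqnSn _))//.
  by rewrite -[leqLHS]expn1 leq_pexp2l.
move=> g [[gX|gX] _]; rewrite mem_cat ?gX//.
by apply/orP; right; apply/mapP; exists (g^-1)%g; rewrite ?invgK.
Qed.

Lemma expressions_word (G : groupType) (X : seq G) (g : G) w (P : G -> nat -> Prop) :
  (forall x, letter X x 1 -> P x 1) -> words X g w ->
  expressions P g [seq (x, 1) | x <- w].
Proof.
move=> XP [wX wg]; split; last by rewrite big_map.
by move=> u /mapP[x xw ->]; apply: XP; split => //; apply: wX.
Qed.

Lemma word_lengthE (G : groupType) (X : seq G) :
  word_length X = weighted_length (letter X).
Proof.
apply/funext => g; congr nat_min; rewrite predeqE => n; split=> -[].
  move=> w /expressions_word wg <-; exists [seq (x, 1) | x <- w]; first exact: wg.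
  by rewrite big_map sum1_size.
move=> s [sP sg] <-; exists [seq u.1 | u <- s].
  split; last by rewrite big_map.
  by move=> x /mapP[u us ->]; have [] := sP u us.
rewrite size_map -sum1_size big_seq [RHS]big_seq.
by apply: eq_bigr => u us; have [_ ->] := sP u us.
Qed.

Section WordLength.
Variables (G : groupType) (X : seq G).
Hypothesis genX : generates X.

Lemma letter_exprP g : expressions (letter X) g !=set0.
Proof.
have [w wg] := genX g; exists [seq (x, 1) | x <- w].
exact: expressions_word wg.
Qed.

Lemma word_length_length : length_function (word_length X).
Proof.
rewrite word_lengthE.
have X0 g : letter X g 0 -> g = 1%g by case.
split.
- exact: weighted_lengthV letter_exprP (@letterV _ _).
- exact: weighted_length_eq0 letter_exprP X0.
- exact: weighted_lengthM letter_exprP.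
- exists (2 * (2 * size X).+1) => // r _.
  exact: weighted_length_card letter_exprP X0 _ (@card_letter _ X) _ _.
Qed.

Lemma word_length1 : word_length X 1%g = 0.
Proof. by apply/(length_eq0 word_length_length). Qed.

Lemma word_lengthM g h :
  word_length X (g * h)%g <= word_length X g + word_length X h.
Proof. exact: length_mul word_length_length g h. Qed.

Lemma word_lengthV g : word_length X (g^-1)%g = word_length X g.
Proof. by rewrite -(length_inv word_length_length). Qed.

Lemma word_length_letter x : x \in X -> word_length X x <= 1.
Proof.
by move=> xX; rewrite word_lengthE; apply: weighted_length_sub; split; auto.
Qed.

Lemma word_length_split g r s : word_length X g <= r + s ->
  exists g1 g2, [/\ g = (g1 * g2)%g, word_length X g1 <= r & word_length X g2 <= s].
Proof.
have word_length_le h w : words X h w -> word_length X h <= size w.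
  by move=> wh; have [_] := nat_minP (ex_intro _ _ (imageP size wh)); apply; exists w.
have [w wg] := genX g.
have [[{wg}w [wX <-] szw] _] := nat_minP (ex_intro _ _ (imageP size wg)).
rewrite {1}/word_length -szw => wrs.
exists (\prod_(x <- take r w) x)%g, (\prod_(x <- drop r w) x)%g.
split.
- by rewrite -big_cat cat_take_drop.
- apply: (@leq_trans (size (take r w))); last by rewrite size_take_min geq_minl.
  by apply: word_length_le; split => // x /mem_take; apply: wX.
- apply: (@leq_trans (size (drop r w))); last by rewrite size_drop leq_subLR.
  by apply: word_length_le; split => // x /mem_drop; apply: wX.
Qed.

Lemma subadditive_le_word_length (N : G -> nat) :
  N 1%g = 0 -> (forall g h, N (g * h)%g <= N g + N h) ->
  exists C, forall g, N g <= C * word_length X g.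
Proof.
(* This sum bounds [N] at every generator and at its inverse. *)
move=> N1 NM; exists (\sum_(x <- X) (N x + N (x^-1)%g)) => g; rewrite word_lengthE.
apply: (subadditive_le_weighted_length letter_exprP N1 NM) => {}g w [gX ->].
rewrite muln1; case: gX => gX; rewrite (perm_big _ (perm_to_rem gX)) big_cons /=.
  by rewrite -addnA leq_addr.
by rewrite invgK [_ + N g]addnC -addnA leq_addr.
Qed.

Lemma length_le_word_length (l : G -> nat) :
  length_function l -> exists C, forall g, l g <= C * word_length X g.
Proof.
move=> lP; apply: subadditive_le_word_length; first exact/(length_eq0 lP).
exact: length_mul.
Qed.

End WordLength.

Section Distortion.
Variables (H G : groupType) (Y : seq H) (X : seq G) (phi : H -> G).

Lemma lower_bound_undistorted c :
  (forall h, word_length Y h <= c * word_length X (phi h)) -> undistorted Y X phi.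
Proof.
move=> hc; exists c.+1 => // r _; apply: nat_max_le => _ [h /= hr <-].
exact: leq_trans (hc h) (leq_mul (leqnSn c) hr).
Qed.

Hypotheses (genX : generates X) (phi_inj : injective phi) (phi1 : phi 1%g = 1%g).
Hypothesis genY : generates Y.

(** The distortion is used at [r = |phi h|_X]. Since [nat_max] defaults to 0, the maximum must be
    shown to exist: balls of [G] are finite and [phi] is injective. *)
Lemma undistorted_lower_bound : undistorted Y X phi ->
  exists c, forall h, word_length Y h <= c * word_length X (phi h).
Proof.
move=> [c c0 disc]; exists c => h.
(* The distortion is bounded for [r > 0] only; length 0 forces [h = 1]. *)
have [X0|X0] := posnP (word_length X (phi h)).
  have /phi_inj-> : phi h = phi 1%g.
    by rewrite phi1; apply/(length_eq0 (word_length_length genX)).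
  by rewrite word_length1.
apply: leq_trans (disc _ X0); set r := word_length X (phi h) in X0 *.
have [a _ /(_ r X0) /card_leI_seq[s _ sP]] := length_card (word_length_length genX).
have /choice[b bP] g : exists b, forall k, phi k = g -> word_length Y k <= b.
  have [[k <-]|nk] := pselect (exists k, phi k = g).
    by exists (word_length Y k) => k' /phi_inj->.
  by exists 0 => k kg; case: nk; exists k.
have [||_] := @nat_maxP
    [set word_length Y h | h in [set h | word_length X (phi h) <= r]]
    (\sum_(g <- s) b g); last by apply; exists h => //; apply: leqnn.
- by exists (word_length Y h); exists h => //; apply: leqnn.
- move=> _ [k /= /sP ks <-]; rewrite (perm_big _ (perm_to_rem ks)) big_cons.
  exact: leq_trans (bP _ k erefl) (leq_addr _ _).
Qed.

End Distortion.

(** * Extension from undistorted subgroups, and the distorted case *)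

Lemma subadditive_mul (f : nat -> nat) c r :
  f 0 = 0 -> (forall r s, f (r + s) <= f r + f s) -> f (c * r) <= c * f r.
Proof.
move=> f0 fD; elim: c => [|c IHc]; first by rewrite mul0n f0.
by rewrite !mulSn (leq_trans (fD _ _))// leq_add2l.
Qed.

Lemma special_extends (G : groupType) (S : pred G) (H : subGroupType S)
    (X : seq G) (Y : seq H) (l : H -> nat) :
  generates X -> generates Y -> undistorted Y X (\val : H -> G) ->
  length_function l -> special Y l ->
  exists L : G -> nat, extension (\val : H -> G) l L.
Proof.
move=> genX genY und lP [f [fD f_homo [c c0 lf]]].
have val1 : \val (1%g : H) = 1%g :> G by exact: gmulf1.
have [d hd] := undistorted_lower_bound genX val_inj val1 genY und.
have XP := word_length_length genX; have YP := word_length_length genY.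
have f0 : f 0 = 0.
  have [_] := lf 1%g; rewrite word_length1// (length_eq0 lP 1%g).2//.
  by rewrite muln0 leqn0 => /eqP.
pose P (g : G) w := letter X g w \/ exists2 h : H, g = \val h & w = l h.
have P0 g : P g 0 -> g = 1%g.
  by case=> [[]|[h -> /esym/(length_eq0 lP)->]].
have PV g w : P g w -> P (g^-1)%g w.
  case=> [/letterV|[h -> ->]]; first by left.
  by right; exists (h^-1)%g; rewrite ?gmulfV// -(length_inv lP).
have genP g : expressions P g !=set0.
  have [w wg] := genX g; exists [seq (x, 1) | x <- w].
  by apply: expressions_word wg => x; left.
have [a a0 acard] := length_card lP.
(* For [w > 0] the sum of the [w]-th powers of two bases is at most the [w]-th power of their
   sum. *)
pose A := (2 * size X).+1 + a.
have cardP w : 0 < w -> ([set g | P g w] #<= `I_(A ^ w))%card.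
  move=> w0; apply/card_leI_seq.
  have [s sX gs] := (card_leI_seq _ _).1 (card_letter X w0).
  have [t tl ht] := (card_leI_seq _ _).1 (acard w w0).
  exists (s ++ [seq \val h | h <- t]).
    rewrite size_cat size_map (leq_trans (leq_add sX tl))//.
    rewrite /A; case: w w0 {gs sX ht tl} => // w _; rewrite !expnS mulnDl.
    have leX m n k : m <= n -> m ^ k <= n ^ k by case: k => // k; rewrite leq_exp2r.
    by apply: leq_add; apply: leq_mul => //; apply: leX; lia.
  move=> g [/gs gw|[h -> wh]]; rewrite mem_cat ?gw//.
  by apply/orP; right; apply/mapP; exists h => //; apply: ht; rewrite /= wh.
pose L := weighted_length P; exists L; split.
  split.
  - exact: weighted_lengthV.
  - exact: weighted_length_eq0.
  - exact: weighted_lengthM.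
  - exists (2 * A); first by rewrite /A; lia.
    by move=> r _; apply: weighted_length_card => //; rewrite /A; lia.
pose N g := f (word_length X g).
have N1 : N 1%g = 0 by rewrite /N word_length1.
have NM g h : N (g * h)%g <= N g + N h.
  by rewrite (leq_trans _ (fD _ _))// f_homo// word_lengthM.
have [b valb] : exists b, forall h : H, word_length X (\val h) <= b * word_length Y h.
  apply: subadditive_le_word_length => // [|g h]; first by rewrite val1 word_length1.
  by rewrite gmulfM word_lengthM.
(* A generator contributes at most [f 1]; for [h] in [H], [f(|h|_X) <= f(b |h|_Y) <= b f(|h|_Y) <= b
   c l(h)]. *)
have LN g : N g <= (f 1 + b * c) * L g.
  apply: subadditive_le_weighted_length => // {}g w [[gX ->]|[h -> ->]].
    rewrite muln1 (leq_trans _ (leq_addr _ _))// f_homo//.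
    case: gX => [|/word_length_letter]; first exact: word_length_letter.
    by rewrite word_lengthV//; apply.
  rewrite (leq_trans (f_homo _ _ (valb h)))// (leq_trans (subadditive_mul _ _ _ _))//.
  have [_ fl] := lf h.
  rewrite mulnDl (leq_trans _ (leq_addl _ _))// -mulnA leq_mul//.
(* [l(h) <= c f(|h|_Y) <= c d f(|h|_X) <= c d (f 1 + b c) L(h)]. The successor makes the constant
   positive, which also covers [L(h) <= l(h)]. *)
exists (c * (d * (f 1 + b * c))).+1 => // h; split.
  rewrite (@leq_trans (l h)) ?leq_pmull//.
  by apply: weighted_length_sub => //; right; exists h.
have [lh _] := lf h.
apply: leq_trans (leq_mul (leqnSn _) (leqnn _)).
rewrite (leq_trans lh)// -!mulnA leq_mul//.
apply: leq_trans (f_homo _ _ (hd h)) _.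
apply: leq_trans (subadditive_mul _ _ f0 fD) _; rewrite leq_mul//.
exact: LN.
Qed.

Lemma distorted_not_extends (H G : groupType) (X : seq G) (Y : seq H) (phi : H -> G) :
  generates X -> generates Y -> distorted Y X phi ->
  exists l : H -> nat, [/\ length_function l, special Y l &
    ~ exists L : G -> nat, extension phi l L].
Proof.
move=> genX genY dist; exists (word_length Y); split.
- exact: word_length_length.
- exists id; split => //; exists 1 => // h; rewrite mul1n; split; exact: leqnn.
move=> [L [LP [c _ Ll]]]; apply: dist.
have [C LC] := length_le_word_length genX LP.
apply: (@lower_bound_undistorted _ _ _ _ _ (c * C)) => h.
have [_ lL] := Ll h; rewrite (leq_trans lL)// -mulnA leq_mul2l.
by rewrite /= LC orbT.
Qed.

(** * Groups of permutations *)

Record permutation (T : Type) := Permutation {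
  perm_fun :> T -> T;
  perm_inv : T -> T;
  perm_funK : cancel perm_fun perm_inv;
  perm_invK : cancel perm_inv perm_fun }.

Section PermutationGroup.
Variable T : Type.
Implicit Types f g h : permutation T.

Lemma permutation_ext f g : f =1 g -> f = g.
Proof.
case: f g => [f f' fK f'K] [g g' gK g'K] /= /funext fg; subst g.
have /funext f'g' : f' =1 g' by move=> x; rewrite -[x in LHS]g'K fK.
by subst g'; congr Permutation; apply: Prop_irrelevance.
Qed.

Definition permutation_one : permutation T :=
  @Permutation T id id (fun=> erefl) (fun=> erefl).
Definition permutation_inv f := Permutation (perm_invK f) (perm_funK f).
(** The right factor acts first. *)
Definition permutation_mul f g :=
  Permutation (can_comp (perm_funK f) (perm_funK g))
    (can_comp (perm_invK g) (perm_invK f)).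

HB.instance Definition _ := gen_eqMixin (permutation T).
HB.instance Definition _ := gen_choiceMixin (permutation T).

Fact permutation_mulA : associative permutation_mul.
Proof. by move=> f g h; apply: permutation_ext. Qed.
Fact permutation_mul1 : left_id permutation_one permutation_mul.
Proof. by move=> f; apply: permutation_ext. Qed.
Fact permutation_mulr1 : right_id permutation_one permutation_mul.
Proof. by move=> f; apply: permutation_ext. Qed.
Fact permutation_mulV : left_inverse permutation_one permutation_inv permutation_mul.
Proof. by move=> f; apply: permutation_ext => x; apply: perm_funK. Qed.
Fact permutation_mulrV : right_inverse permutation_one permutation_inv permutation_mul.
Proof. by move=> f; apply: permutation_ext => x; apply: perm_invK. Qed.

HB.instance Definition _ := isGroup.Build (permutation T)
  permutation_mulA permutation_mul1 permutation_mulr1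
  permutation_mulV permutation_mulrV.

End PermutationGroup.

Section GeneratedSubgroup.
Variables (P : groupType) (X : seq P).

Definition in_generated : pred P := fun g => `[< words X g !=set0 >].

Record generated := Generated { generated_val :> P; _ : in_generated generated_val }.

HB.instance Definition _ := [isSub for generated_val].
HB.instance Definition _ := [Choice of generated by <:].

Fact generated_group_closed : group_closed in_generated.
Proof.
split; first by apply/asboolP; exists [::]; split; rewrite ?big_nil.
move=> _ _ /asboolP[v [vX <-]] /asboolP[w [wX <-]]; apply/asboolP.
exists (v ++ rev [seq (x^-1)%g | x <- w]); split.
  move=> x; rewrite mem_cat mem_rev => /orP[/vX//|/mapP[y /wX yX ->]].
  by rewrite invgK; case: yX; auto.
rewrite big_cat; congr (_ * _)%g.
elim: w {wX} => [|x w IHw]; first by rewrite !big_nil invg1.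
by rewrite /= rev_cons -cats1 big_cat IHw big_seq1 big_cons invgM.
Qed.

HB.instance Definition _ :=
  SubChoice_isSubGroup.Build P in_generated generated generated_group_closed.

Lemma mem_in_generated x : x \in X -> in_generated x.
Proof.
move=> xX; apply/asboolP; exists [:: x]; split; last by rewrite big_seq1.
by move=> y; rewrite inE => /eqP->; left.
Qed.

Definition generators : seq generated := pmap insub X.

Lemma mem_generators (x : generated) : (x \in generators) = (val x \in X).
Proof. by rewrite /generators mem_pmap_sub. Qed.

Lemma generates_generators : generates generators.
Proof.
case=> g gG; have /asboolP[w [wX wg]] := gG.
have wG x : x \in w -> in_generated x.
  move=> /wX[/mem_in_generated//|/mem_in_generated xG].
  by rewrite -[x]invgK; apply: (group_closedV generated_group_closed).
exists (pmap insub w); split.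
  move=> x; rewrite mem_pmap_sub => /wX; rewrite !mem_generators/=; auto.
apply: val_inj => /=; rewrite -wg => {wg wX gG}.
elim: w wG => [|x w IHw] wG; first by rewrite !big_nil.
rewrite big_cons /= (insubT in_generated (wG x _)) ?inE ?eqxx// => xG.
rewrite big_cons -IHw// => y yw; apply: wG; by rewrite inE yw orbT.
Qed.

End GeneratedSubgroup.

(** * The ambient group *)

Section Construction.
Variables (H : groupType) (len : H -> nat) (Z : set H) (kappa : H -> H).

(* The point [(a, (p, t) :: r)] lies in the fibre over [a]; this fibre contains
   a copy of the point [(p, r)] for each tag [t]. *)
Definition point := (H * seq (H * (int * int)))%type.

(* The quadrant is chosen so that, for the unit shifts s and u of the two
   coordinates, (1 - s)(1 - u) maps its indicator function to the indicator
   function of the single tag [base_tag]. *)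
Definition twisted (t : int * int) : bool := (0 < t.1)%R && (0 <= t.2)%R.

Definition twist (t : int * int) (c : H) : H := if twisted t then c else 1%g.

(** The change of [p] that leaves [(twist t c)^-1 * p] invariant when the tag passes from [t] to
    [t']. *)
Definition transport (c : H) (t t' : int * int) (p : H) : H :=
  (twist t' c * (twist t c)^-1 * p)%g.

Lemma transportK c t t' : cancel (transport c t t') (transport c t' t).
Proof. by move=> p; rewrite /transport !mulgA !mulgVK mulgV mul1g. Qed.

Definition tag_right (t : int * int) : int * int := (t.1 + 1, t.2)%R.
Definition tag_left (t : int * int) : int * int := (t.1 - 1, t.2)%R.
Definition tag_up (t : int * int) : int * int := (t.1, t.2 + 1)%R.
Definition tag_down (t : int * int) : int * int := (t.1, t.2 - 1)%R.

Lemma tag_rightK : cancel tag_right tag_left.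
Proof. by case=> i k; rewrite /tag_left /= GRing.addrK. Qed.
Lemma tag_leftK : cancel tag_left tag_right.
Proof. by case=> i k; rewrite /tag_right /= GRing.subrK. Qed.
Lemma tag_upK : cancel tag_up tag_down.
Proof. by case=> i k; rewrite /tag_down /= GRing.addrK. Qed.
Lemma tag_downK : cancel tag_down tag_up.
Proof. by case=> i k; rewrite /tag_up /= GRing.subrK. Qed.

Definition move_tag (D : set H) (k : H -> H) (m : int * int -> int * int)
    (x : point) : point :=
  if x is (a, (p, t) :: r) then
    if `[< D a >] then (a, (transport (k a) t (m t) p, m t) :: r) else x
  else x.

Lemma move_tagK D k m m' : cancel m m' -> cancel (move_tag D k m) (move_tag D k m').
Proof.
move=> mK [a [|[p t] r]] //=; case: ifP => Da; rewrite /= Da //.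
by rewrite mK transportK.
Qed.

Definition shift_fun (h : H) (x : point) : point := ((h * x.1)%g, x.2).

Lemma move_tag_out D k m x : ~ D x.1 -> move_tag D k m x = x.
Proof. by case: x => a [|[p t] r] //= nD; rewrite asboolF. Qed.

Lemma move_tag_in D k m a p t r : D a ->
  move_tag D k m (a, (p, t) :: r) = (a, (transport (k a) t (m t) p, m t) :: r).
Proof. by move=> Da; rewrite /= asboolT. Qed.

Lemma move_tag_nil D k m a : move_tag D k m (a, [::]) = (a, [::]).
Proof. by []. Qed.

Lemma move_tag_fst D k m x : (move_tag D k m x).1 = x.1.
Proof. by case: x => a [|[p t] r] //=; case: ifP. Qed.

(** Conjugation by a shift stays in the family [move_tag]; applied to [fibre_right], it makes
    [kappa z] the coefficient over 1. *)
Lemma move_tag_shift D k m z x :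
  shift_fun z^-1 (move_tag D k m (shift_fun z x)) =
  move_tag [set a | D (z * a)%g] (fun a => k (z * a)%g) m x.
Proof.
case: x => a [|[p t] r]; rewrite /shift_fun /= ?mulKg//.
by case: ifP => _ /=; rewrite mulKg.
Qed.

Definition fibre_right : permutation point :=
  Permutation (move_tagK Z kappa tag_rightK) (move_tagK Z kappa tag_leftK).

Definition fibre_up : permutation point :=
  Permutation (move_tagK [set 1%g] (fun=> 1%g) tag_upK)
    (move_tagK [set 1%g] (fun=> 1%g) tag_downK).

Lemma shift_funK h : cancel (shift_fun h) (shift_fun h^-1).
Proof. by case=> a s; rewrite /shift_fun /= mulKg. Qed.
Lemma shift_funVK h : cancel (shift_fun h^-1) (shift_fun h).
Proof. by case=> a s; rewrite /shift_fun /= mulVKg. Qed.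

Definition shift (h : H) : permutation point :=
  Permutation (shift_funK h) (shift_funVK h).

Definition on_sheet_fun (f : point -> point) (x : point * bool) : point * bool :=
  if x.2 then x else (f x.1, x.2).

Lemma on_sheet_funK f g : cancel f g -> cancel (on_sheet_fun f) (on_sheet_fun g).
Proof. by move=> fK [w []]; rewrite /on_sheet_fun //= fK. Qed.

Definition on_sheet (f : permutation point) : permutation (point * bool) :=
  Permutation (on_sheet_funK (perm_funK f)) (on_sheet_funK (perm_invK f)).

Lemma on_sheetM f g : on_sheet (f * g)%g = (on_sheet f * on_sheet g)%g.
Proof. by apply: permutation_ext => -[w []]. Qed.

Lemma on_sheetV f : on_sheet (f^-1)%g = ((on_sheet f)^-1)%g.
Proof. by apply: permutation_ext => -[w []]. Qed.

Definition base_tag : int * int := (1, 0)%R.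

(** The map [(p, r) |-> (1, (p, base_tag) :: r)] is injective but not onto. Sending the first sheet
    into the second by it, and its image back, gives an involution. *)
Definition insert_swap_fun (x : point * bool) : point * bool :=
  let: (a, s, b) := x in
  if b then
    if s is (p, t) :: r then
      if (a == 1%g) && (t == base_tag) then (p, r, false) else x
    else x
  else (1%g, (a, base_tag) :: s, true).

Lemma insert_swap_funK : involutive insert_swap_fun.
Proof.
case=> [[a s] []] /=; last by rewrite !eqxx.
case: s => [|[p t] r] //=; case: ifP => [/andP[/eqP-> /eqP->]//|].
by move=> /= ->.
Qed.

Definition insert_swap := Permutation insert_swap_funK insert_swap_funK.

Definition sheet_swap_fun (x : point * bool) : point * bool := (x.1, ~~ x.2).

Lemma sheet_swap_funK : involutive sheet_swap_fun.
Proof. by case=> w b; rewrite /sheet_swap_fun /= negbK. Qed.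

Definition sheet_swap := Permutation sheet_swap_funK sheet_swap_funK.

Definition push_right := on_sheet fibre_right.
Definition push_up := on_sheet fibre_up.
Definition translation (h : H) := on_sheet (shift h).

Lemma translationM : {morph translation : h k / (h * k)%g}.
Proof.
move=> h k; rewrite /translation -on_sheetM; congr on_sheet.
by apply: permutation_ext => -[a s]; rewrite /= /shift_fun /= mulgA.
Qed.

Lemma translation1 : translation 1%g = 1%g.
Proof. by apply: (mulIg (translation 1%g)); rewrite mul1g -translationM mul1g. Qed.

HB.instance Definition _ :=
  isUMagmaMorphism.Build H (permutation (point * bool)) translation
    (translation1, translationM).

Lemma translation_inj : injective translation.
Proof.
move=> h k /(congr1 (fun f : permutation _ => (f (1%g, [::], false)).1.1)).
by rewrite /= !mulg1.
Qed.

Hypotheses (Z1 : Z 1%g) (kappa1 : kappa 1%g = 1%g).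

Definition fibre_commutator (z : H) : permutation point :=
  ((shift z)^-1 * fibre_right * shift z * fibre_up *
     ((shift z)^-1 * fibre_right^-1 * shift z) * fibre_up^-1)%g.

Lemma fibre_commutatorE z (x : point) : Z z -> fibre_commutator z x =
  if x is (a, (p, t) :: r) then
    if (a == 1%g) && (t == base_tag) then (a, ((kappa z * p)%g, t) :: r) else x
  else x.
Proof.
move=> Zz; pose Dz : set H := [set a | Z (z * a)%g]; pose kz a := kappa (z * a)%g.
pose D1 : set H := [set 1%g]; pose k1 (_ : H) : H := 1%g.
have -> : fibre_commutator z x = move_tag Dz kz tag_right (move_tag D1 k1 tag_up
    (move_tag Dz kz tag_left (move_tag D1 k1 tag_down x))).
  by rewrite -[in RHS](@move_tag_shift Z kappa) -[move_tag Dz _ _ _]move_tag_shift.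
case: x => a [|[p t] r]; first by rewrite !move_tag_nil.
have [->|/eqP a1] := eqVneq a 1%g; last first.
  (* Away from the fibre over 1 the vertical moves are trivial and the horizontal ones cancel. *)
  rewrite [move_tag D1 _ tag_down _]move_tag_out// [move_tag D1 _ _ _]move_tag_out.
    exact/move_tagK/tag_leftK.
  by rewrite move_tag_fst.
have Dz1 : Dz 1%g by rewrite /Dz /= mulg1.
rewrite !move_tag_in// /kz /k1 mulg1 /=; case: t => i k.
have -> : tag_right (tag_up (tag_left (tag_down (i, k)))) = (i, k).
  by rewrite /tag_right /tag_up /tag_left /tag_down /= !GRing.subrK.
case: ifP => [/eqP[-> ->]|tb].
  by rewrite /transport /twist /twisted /= invg1 !mulg1 !mul1g.
have -> : tag_up (tag_left (tag_down (i, k))) = tag_left (i, k).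
  by rewrite /tag_up /tag_left /tag_down /= GRing.subrK.
have one q t t' : transport 1%g t t' q = q.
  by rewrite /transport /twist !if_same invg1 !mul1g.
(* For [i = 1] the tags to the left are untwisted, and [t] and [tag_down t] are both twisted or both
   not, as [t] is not [base_tag]. For other [i] no horizontal move crosses the boundary of the
   quadrant. *)
rewrite !one; congr (_, (_, _) :: _); have [i1|i1] := eqVneq i 1%R.
  have tw1 : twisted (i, k) = twisted (tag_down (i, k)).
    by move: tb; rewrite /twisted /base_tag xpair_eqE i1 /=; lia.
  have tw2 k' : twisted (tag_left (i, k')) = false by rewrite /twisted i1 /=; lia.
  by rewrite /transport /twist tw1 !tw2 invg1 mulg1 mul1g mulVKg.
have tw k' : twisted (tag_left (i, k')) = twisted (i, k').
  by move: i1; rewrite /twisted /=; lia.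
by rewrite /transport /twist !tw !mulgV !mul1g.
Qed.

(** The two swaps carry a first-sheet point [(a, s)] to [(1, (a, base_tag) :: s)] on the same sheet,
    where the commutator multiplies [a] by [kappa z]. Second-sheet points are carried to points that
    it fixes. *)
Lemma translation_kappa z : Z z ->
  translation (kappa z) = (insert_swap * sheet_swap *
    (((translation z)^-1 * push_right * translation z) * push_up *
     ((translation z)^-1 * push_right^-1 * translation z) * push_up^-1) *
    sheet_swap * insert_swap)%g.
Proof.
move=> Zz; rewrite /push_right /push_up /translation.
rewrite -!on_sheetV -!on_sheetM -/(fibre_commutator z).
have fE x := fibre_commutatorE x Zz; move: (fibre_commutator z) fE => f fE.
apply: permutation_ext => -[[a s] []]; last first.
  by rewrite /= /on_sheet_fun /= fE !eqxx /= !eqxx.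
case: s => [|[p t] r].
  by rewrite /= /on_sheet_fun /= fE.
rewrite /=; case: ifP => [/andP[/eqP-> /eqP->]//|at1].
by rewrite /= /on_sheet_fun /= fE at1 /= at1.
Qed.

(* For [a] in [Z], the minimum is attained at [b = a] because [kappa] is
   1-Lipschitz on [Z]. It interpolates between these fibres so that translations
   by generators change the height by at most 1. *)
Fixpoint height_at (s : seq (H * (int * int))) (a : H) : nat :=
  if s is (p, t) :: r then
    if twisted t then
      nat_min [set height_at r ((kappa b)^-1 * p)%g + len (a / b)%g | b in Z]
    else height_at r p
  else len a.

Definition height (x : point * bool) : nat := height_at x.1.2 x.1.1.

(** * Height estimates and absence of distortion *)

Hypotheses (len1 : len 1%g = 0) (lenV : forall a, len (a^-1)%g = len a)
  (lenM : forall a b, len (a * b)%g <= len a + len b).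
Hypothesis kappa_lip : forall a b, Z a -> Z b ->
  len ((kappa a)^-1 * kappa b)%g <= len (a / b)%g.

Lemma height_at_set (r : seq (H * (int * int))) a p :
  [set height_at r ((kappa b)^-1 * p)%g + len (a / b)%g | b in Z] !=set0.
Proof. by apply: image_nonempty; exists 1%g. Qed.

(** A minimizing [b] for [a] is also a candidate for [h * a]. With an untwisted head, the height
    does not depend on [a]. *)
Lemma height_at_lip s h a : height_at s (h * a)%g <= height_at s a + len h.
Proof.
case: s => [|[p t] r] /=; first by rewrite addnC.
case: ifP => _; last exact: leq_addr.
have [_ /(_ (height_at r ((kappa _)^-1 * p)%g + len (_ * a / _)%g))] :=
  nat_minP (height_at_set r (h * a)%g p).
have [[b Zb <-] _] := nat_minP (height_at_set r a p).
move=> /(_ b h b) /(_ (ex_intro2 _ _ b Zb erefl)) /leq_trans; apply.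
by rewrite -addnA leq_add2l -mulgA addnC.
Qed.

Lemma height_at_fibre a p t r : Z a ->
  height_at ((p, t) :: r) a = height_at r ((twist t (kappa a))^-1 * p)%g.
Proof.
move=> Za; rewrite /= /twist; case: ifP => _; last by rewrite invg1 mul1g.
have [[b Zb eb] lb] := nat_minP (height_at_set r a p).
apply/eqP; rewrite eqn_leq; apply/andP; split.
  by apply: lb; exists a => //; rewrite divgg len1 addn0.
rewrite -eb.
have -> : ((kappa a)^-1 * p = ((kappa a)^-1 * kappa b) * ((kappa b)^-1 * p))%g.
  by rewrite mulgA mulgK.
by rewrite (leq_trans (height_at_lip _ _ _))// leq_add2l kappa_lip.
Qed.

(** Over [Z] the height depends only on the tail and on [(twist t (kappa a))^-1 * p], which
    [transport] preserves. *)
Lemma height_move_tag D k m x : (forall a, D a -> Z a) ->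
  (forall a, D a -> kappa a = k a) ->
  height (on_sheet_fun (move_tag D k m) x) = height x.
Proof.
move=> DZ Dk; case: x => [[a [|[p t] r]] []] //; rewrite /on_sheet_fun /height.
rewrite [in LHS]/=; case: asboolP => // Da.
rewrite !height_at_fibre ?Dk//; try exact: DZ.
by rewrite /transport !mulgA mulVg mul1g.
Qed.

Lemma height_push_right x : height (push_right x) = height x.
Proof. exact: height_move_tag. Qed.

Lemma height_push_rightV x : height ((push_right^-1)%g x) = height x.
Proof. exact: height_move_tag. Qed.

Lemma height_push_up x : height (push_up x) = height x.
Proof. by apply: height_move_tag => a /= ->. Qed.

Lemma height_push_upV x : height ((push_up^-1)%g x) = height x.
Proof. by apply: height_move_tag => a /= ->. Qed.

(** Over 1 the twist is trivial because [kappa 1 = 1], so inserting a head there keeps the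
    height. *)
Lemma height_insert_swap x : height (insert_swap x) = height x.
Proof.
have fibre1 a s : height_at ((a, base_tag) :: s) 1%g = height_at s a.
  have twist1 t : twist t 1%g = 1%g by rewrite /twist if_same.
  by rewrite height_at_fibre// kappa1 twist1 invg1 mul1g.
case: x => [[a s] []]; last exact: fibre1.
case: s => [|[p t] r] //; rewrite [insert_swap _]/=.
case: ifP => [/andP[/eqP-> /eqP->]|//]; exact/esym/fibre1.
Qed.

Lemma height_translation h x : height (translation h x) <= height x + len h.
Proof.
case: x => [[a s] []]; first by rewrite /= leq_addr.
exact: height_at_lip.
Qed.

Variable Y : seq H.
Hypotheses (genY : generates Y) (lenY : forall y, y \in Y -> len y <= 1).

Definition ambient_generators : seq (permutation (point * bool)) :=
  [:: push_right; push_up; insert_swap; sheet_swap] ++ [seq translation y | y <- Y].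

Definition ambient : groupType := generated ambient_generators.

Lemma height_ambient_generator f x : f \in ambient_generators ->
  height (f x) <= (height x).+1 /\ height ((f^-1)%g x) <= (height x).+1.
Proof.
have translationV y : ((translation y)^-1 = translation y^-1)%g by rewrite gmulfV.
rewrite mem_cat => /orP[|/mapP[y yY ->]]; last first.
  rewrite translationV -addn1; split;
    apply: leq_trans (height_translation _ _) _; rewrite leq_add2l.
    exact: lenY.
  by rewrite lenV lenY.
rewrite !inE => /or4P[] /eqP->.
- by rewrite height_push_right height_push_rightV.
- by rewrite height_push_up height_push_upV.
- by have -> : (insert_swap^-1 = insert_swap)%g by []; rewrite height_insert_swap.
- by case: x => [[a s] b].
Qed.

Lemma translation_in_generated h : in_generated ambient_generators (translation h).
Proof.
have [w [wY <-]] := genY h.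
have [gen1 _] := generated_group_closed ambient_generators.
elim: w wY => [|y w IHw] wY; first by rewrite big_nil gmulf1.
have translationY x : x \in Y -> in_generated ambient_generators (translation x).
  by move=> xY; apply: mem_in_generated; rewrite mem_cat map_f ?orbT.
rewrite big_cons gmulfM; apply: group_closedM (generated_group_closed _) _ _ _ _.
  have [/translationY//|/translationY] := wY y (mem_head _ _).
  by rewrite gmulfV => /(group_closedV (generated_group_closed _)); rewrite invgK.
by apply: IHw => v vw; apply: wY; rewrite inE vw orbT.
Qed.

Definition ambient_embedding (h : H) : ambient := Generated (translation_in_generated h).

Lemma ambient_embeddingM : {morph ambient_embedding : h k / (h * k)%g}.
Proof. by move=> h k; apply: val_inj; apply: translationM. Qed.

HB.instance Definition _ :=
  isMultiplicative.Build H ambient ambient_embedding ambient_embeddingM.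

Lemma height_ambient (g : ambient) x :
  height (val g x) <= height x + word_length (generators ambient_generators) g.
Proof.
rewrite word_lengthE.
have genX := @generates_generators _ ambient_generators.
have [s [sX <-] ->] := weighted_lengthP (letter_exprP genX) g.
elim: s sX => [|u s IHs] sX; first by rewrite !big_nil addn0.
rewrite !big_cons.
have [uX ->] := sX u (mem_head _ _).
have {}IHs := IHs (fun v vs => sX v (@mem_behead _ (u :: s) v vs)).
have le1 : forall y, height (val u.1 y) <= (height y).+1.
  by move=> y; case: uX; rewrite mem_generators => /(height_ambient_generator y)[].
by rewrite [1 + _]addnC addnA addn1; apply: leq_trans (le1 _) _; rewrite ltnS.
Qed.

Lemma len_ambient_embedding h :
  len h <= word_length (generators ambient_generators) (ambient_embedding h).
Proof.
have := height_ambient (ambient_embedding h) (1%g, [::], false).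
by rewrite /height /= mulg1 len1.
Qed.

Lemma ambient_embedding_inj : injective ambient_embedding.
Proof. by move=> h k /(congr1 val)/translation_inj. Qed.

(** The coefficients do not depend on [z], so a length function on [ambient] at [kappa z] is bounded
    linearly by its value at [z]. *)
Lemma kappa_word : exists b c d e : ambient, forall z, Z z ->
  ambient_embedding (kappa z) =
  (b * c * (((ambient_embedding z)^-1 * d * ambient_embedding z) * e *
    ((ambient_embedding z)^-1 * d^-1 * ambient_embedding z) * e^-1) * c * b)%g.
Proof.
have gen i : i < 4 ->
    in_generated ambient_generators (nth insert_swap ambient_generators i).
  by move=> i4; apply/mem_in_generated/mem_nth; rewrite size_cat ltn_addr.
exists (Generated (gen 2 isT)), (Generated (gen 3 isT)), (Generated (gen 0 isT)),
  (Generated (gen 1 isT)).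
by move=> z Zz; apply: val_inj; apply: translation_kappa.
Qed.

End Construction.

(** * Length functions that are not special *)

Section NotSpecial.
Variables (H : groupType) (Y : seq H) (l : H -> nat).
Hypotheses (genY : generates Y) (lP : length_function l).
Let len := word_length Y.

(** If no witness exists for some [n] and [N], then [l] is equivalent to [f(|h|_Y)], where [f r] is
    the maximum of [l] on the ball of radius [r]. Indeed [f(|h|)] is at most [4 f(|h| / 4) + f 3],
    and [f(|h| / 4)] is a value [l k] with [4 |k| <= |h|]. *)
Lemma not_special_witness : ~ special Y l -> forall n N, exists z k,
  [/\ N <= len z, 4 * len k <= len z & n * l z < l k].
Proof.
move=> nspec n N; apply: contrapT => nex; apply: nspec.
have {}nex z k : N <= len z -> 4 * len k <= len z -> l k <= n * l z.
  by move=> zN kz; rewrite leqNgt; apply/negP => nlk; apply: nex; exists z, k.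
have [C lC] := length_le_word_length genY lP.
pose ball r := [set l h | h in [set h | len h <= r]].
pose f r := nat_max (ball r).
have ballP r : ball r (f r) /\ ubound (ball r) (f r).
  apply: (@nat_maxP _ (C * r)).
    by exists (l 1%g), 1%g; rewrite /= /len ?word_length1.
  move=> _ [h /= hr <-]; apply: leq_trans (lC h) _; rewrite leq_mul2l.
  by apply/orP; right.
have f_ge h r : len h <= r -> l h <= f r.
  by move=> hr; have [_] := ballP r; apply; exists h.
have f_homo : {homo f : r s / r <= s}.
  move=> r s rs; have [[h /= hr <-] _] := ballP r.
  by apply: f_ge; apply: leq_trans hr rs.
have fD r s : f (r + s) <= f r + f s.
  have [[h /= hrs <-] _] := ballP (r + s).
  have [h1 [h2 [-> h1r h2s]]] := word_length_split genY hrs.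
  by rewrite (leq_trans (length_mul lP _ _))// leq_add// f_ge.
have f0 : f 0 = 0.
  have [[h /= h0 <-] _] := ballP 0; apply/(length_eq0 lP).
  by apply/(length_eq0 (word_length_length genY))/eqP; rewrite -leqn0.
(* Since [l h >= 1] for [h] other than 1, the summand [f N] handles [|h| < N], and [4 * n + f 3]
   handles the rest. *)
exists f; split => //; exists (f N + 4 * n + f 3).+1 => // h; split.
  exact: leq_trans (f_ge h _ (leqnn _)) (leq_pmull _ _).
have [h0|lh0] := posnP (l h).
  by rewrite (length_eq0 lP h).1// /len word_length1// f0.
have [hN|Nh] := ltnP (len h) N.
  by rewrite (leq_trans (f_homo _ _ (ltnW hN)))//; nia.
have : f (len h) <= 4 * f (len h %/ 4) + f 3.
  rewrite [in X in X <= _](divn_eq (len h) 4) mulnC (leq_trans (fD _ _))//.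
  by rewrite leq_add ?subadditive_mul// f_homo// -ltnS ltn_mod.
have [[k /= kh <-] _] := ballP (len h %/ 4).
have : l k <= n * l h.
  by apply: nex => //; rewrite (leq_trans (leq_mul (leqnn 4) kh))// mulnC leq_trunc_div.
rewrite -/len; have := leq_pmulr (f N + 4 * n + f 3) lh0.
by rewrite !mulSn !mulnDl; nia.
Qed.

Lemma sparse_witnesses : ~ special Y l -> exists (Z : set H) (kappa : H -> H),
  [/\ Z 1%g, kappa 1%g = 1%g,
      forall a b, Z a -> Z b -> len ((kappa a)^-1 * kappa b)%g <= len (a / b)%g &
      forall n, exists2 z, Z z & n * l z < l (kappa z)].
Proof.
move=> /not_special_witness nspec.
have /choice[w wP] (p : nat * nat) : exists v : H * H,
    [/\ p.2 <= len v.1, 4 * len v.2 <= len v.1 & p.1 * l v.1 < l v.2].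
  by have [z [k zk]] := nspec p.1 p.2; exists (z, k).
(* The pair [u n] has ratio above [n], and lengths at least double at each step; the initial bound 1
   keeps 1 out of the sequence. *)
pose fix u n := if n is m.+1 then w (n, 2 * len (u m).1) else w (0, 1).
have uk n : 4 * len (u n).2 <= len (u n).1.
  by case: n => [|n]; [have [] := wP (0, 1)|have [] := wP (n.+1, 2 * len (u n).1)].
have ul n : n * l (u n).1 < l (u n).2.
  by case: n => [|n]; [have [] := wP (0, 1)|have [] := wP (n.+1, 2 * len (u n).1)].
have uS n : 2 * len (u n).1 <= len (u n.+1).1.
  by have [] := wP (n.+1, 2 * len (u n).1).
have u_gt0 n : 0 < len (u n).1.
  elim: n => [|n IHn]; first by have [] := wP (0, 1).
  by have := uS n; lia.
clearbody u; have u_lt m n : m < n -> 2 * len (u m).1 <= len (u n).1.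
  elim: n => // n IHn; rewrite ltnS leq_eqVlt => /orP[/eqP->|/IHn mn]; first exact: uS.
  by have := uS n; lia.
have u_inj m n : (u m).1 = (u n).1 -> m = n.
  by case: (ltngtP m n) => // /u_lt; have := u_gt0 m; have := u_gt0 n => + + + e;
    rewrite e; lia.
have lenV a : len (a^-1)%g = len a := word_lengthV genY a.
have lenM a b : len (a * b)%g <= len a + len b := word_lengthM genY a b.
have len1 : len 1%g = 0 := word_length1 genY.
(* Lengths increase strictly, so [kappa] is well defined on the sequence; the default value gives
   [kappa 1 = 1]. *)
pose kappa a := (xget (1, 1)%g [set v | exists n, v = u n /\ v.1 = a]).2.
have kappaE n : kappa (u n).1 = (u n).2.
  rewrite /kappa (@xget_unique _ _ _ (u n)) //; first by exists n.
  by move=> _ [m [-> /u_inj->]].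
have kappa1 : kappa 1%g = 1%g.
  rewrite /kappa xgetPN // => v [n [-> n1]]; have := u_gt0 n.
  by rewrite n1 len1.
exists [set a | a = 1%g \/ exists n, a = (u n).1], kappa; split => //.
- by left.
(* With [|z_m| <= |z_n| / 2], the left side is at most [(|z_m| + |z_n|) / 4 <= 3 |z_n| / 8], while
   the right side is at least [|z_n| - |z_m| >= |z_n| / 2]. *)
- have lip m n : m < n -> len ((u m).2^-1 * (u n).2)%g <= len ((u m).1 / (u n).1)%g.
    move=> mn; have := lenM ((u n).1 / (u m).1)%g (u m).1.
    have := lenM (u m).2^-1%g (u n).2; rewrite lenV mulgVK.
    have -> : len ((u n).1 / (u m).1)%g = len ((u m).1 / (u n).1)%g.
      by rewrite -[LHS]lenV invgF.
    have arith a b p q x y : x <= p + q -> a <= y + b -> 2 * b <= a ->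
      4 * p <= b -> 4 * q <= a -> x <= y by lia.
    move=> kd ud; exact: arith kd ud (u_lt _ _ mn) (uk m) (uk n).
  move=> _ _ [->|[m ->]] [->|[n ->]]; rewrite ?kappa1 ?kappaE.
  + by rewrite mulVg len1.
  + rewrite invg1 mul1g div1g lenV; have := uk n; lia.
  + rewrite mulg1 divg1 lenV; have := uk m; lia.
  have [mn|nm|<-] := ltngtP m n; first exact: lip.
    by have := lip _ _ nm; rewrite -lenV -[leqRHS]lenV invgM invgK invgF.
  by rewrite mulVg len1.
by move=> n; exists (u n).1; [right; exists n|rewrite kappaE].
Qed.

End NotSpecial.

(** Up to inversion, [z] occurs four times in the word and each coefficient twice. *)
Lemma length_conjugation_word (G : groupType) (L : G -> nat) b c d e z :
  length_function L ->
  L (b * c * ((z^-1 * d * z) * e * (z^-1 * d^-1 * z) * e^-1) * c * b)%g <=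
  4 * L z + 2 * (L b + L c + L d + L e).
Proof.
move=> LP; have LV x : L (x^-1)%g = L x by rewrite -(length_inv LP).
have LM x y m n : L x <= m -> L y <= n -> L (x * y)%g <= m + n.
  by move=> xm yn; rewrite (leq_trans (length_mul LP _ _))// leq_add.
have -> : 4 * L z + 2 * (L b + L c + L d + L e) = L b + L c +
    ((L z + L d + L z) + L e + (L z + L d + L z) + L e) + L c + L b by lia.
by do !apply: (LM); rewrite ?LV.
Qed.

Lemma not_special_not_extends (H : groupType) (Y : seq H) (l : H -> nat) :
  generates Y -> length_function l -> ~ special Y l ->
  exists (G : groupType) (X : seq G) (phi : {multiplicative H -> G}),
    [/\ generates X, injective phi, undistorted Y X phi &
        ~ (exists L : G -> nat, extension phi l L)].
Proof.
move=> genY lP /(sparse_witnesses genY lP)[Z [kappa [Z1 kappa1 kappa_lip ln]]].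
pose phi : {multiplicative H -> _} := ambient_embedding Z kappa genY.
pose X := generators (ambient_generators Z kappa Y).
have phi_len h : word_length Y h <= 1 * word_length X (phi h).
  rewrite mul1n; apply: (@len_ambient_embedding _ (word_length Y)) => //.
  - exact: word_length1.
  - exact: word_lengthV.
  - exact: word_lengthM.
  - exact: word_length_letter.
exists _, X, phi; split.
- exact: generates_generators.
- exact: ambient_embedding_inj.
- exact: lower_bound_undistorted phi_len.
move=> [L [LP [c _ Ll]]].
have [b [d [e [g gP]]]] := kappa_word Z kappa genY.
have LC z : Z z -> L (phi (kappa z)) <= 4 * L (phi z) + 2 * (L b + L d + L e + L g).
  by move=> /gP e_kz; rewrite [phi _]e_kz; apply: length_conjugation_word.
pose M := 2 * (L b + L d + L e + L g).
(* If [L z >= 1], then [l(kappa z) <= c L(kappa z) <= c (4 + M) L(z) <= c (4 + M) c l(z)], against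
   the choice of [z]. The case [l z = 0] gives [z = 1 = kappa z]. *)
have [z Zz] := ln (c * ((4 + M) * c)); rewrite ltnNge => /negP; apply.
have [_ lk] := Ll (kappa z); have [Lz _] := Ll z.
have [lz|lz] := posnP (l z).
  have -> : z = 1%g by apply/(length_eq0 lP).
  by rewrite kappa1 (length_eq0 lP 1%g).2.
rewrite (leq_trans lk)// -!mulnA leq_mul2l; apply/orP; right.
have Lz1 : 0 < L (phi z).
  rewrite lt0n; apply/eqP => Lz0; move: lz; have [_] := Ll z.
  by rewrite /= Lz0 muln0 leqn0 => /eqP->.
by have := LC z Zz; rewrite -/M; move: Lz Lz1; rewrite /=; nia.
Qed.

Theorem theorem2p11 :
  (forall (G : groupType) (S : pred G) (H : subGroupType S)
          (X : seq G) (Y : seq H) (l : H -> nat),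
     generates X -> generates Y ->
     undistorted Y X (\val : H -> G) ->
     length_function l -> special Y l ->
     exists L : G -> nat, extension (\val : H -> G) l L)
  /\
  (forall (H : groupType) (Y : seq H) (l : H -> nat),
     generates Y -> length_function l -> ~ special Y l ->
     exists (G : groupType) (X : seq G) (phi : {multiplicative H -> G}),
       [/\ generates X, injective phi, undistorted Y X phi &
           ~ (exists L : G -> nat, extension phi l L)])
  /\
  (forall (G : groupType) (S : pred G) (H : subGroupType S)
          (X : seq G) (Y : seq H),
     generates X -> generates Y ->
     distorted Y X (\val : H -> G) ->
     exists l : H -> nat,
       [/\ length_function l, special Y l &
           ~ (exists L : G -> nat, extension (\val : H -> G) l L)]).
Proof.
split=> [G S H X Y l|]; first exact: special_extends.
split=> [H Y l|G S H X Y genX genY]; first exact: not_special_not_extends.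
exact: distorted_not_extends.
Qed.
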